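(* Let $X$ be a strongly $0$-dimensional metrizable space which is $\sigma$-compact and satisfies $3\le\operatorname{card}(X)\le\mathfrak{c}$. Then the set $\mathrm{R}(X)$ is comeager in $(\mathrm{Met}(X),\mathcal{D}_X)$.
   Context: For a topological space $X$, $\mathrm{Met}(X)$ denotes the set of all metrics on $X$ generating the topology of $X$, equipped with the supremum metric $\mathcal{D}_X(d,e)=\sup_{x,y\in X}|d(x,y)-e(x,y)|$ (values in $[0,\infty]$) and the topology generated by its open balls. $\mathfrak{c}$ is the cardinality of the continuum. A topological space is strongly $0$-dimensional if for every pair $A,B$ of disjoint closed subsets there is a clopen set $V$ with $A\subseteq V$, $V\cap B=\emptyset$. A metric $d$ on $X$ is rigid if every bijective isometry $f\colon(X,d)\to(X,d)$ is the identity; $\mathrm{R}(X)$ is the set of rigid metrics in $\mathrm{Met}(X)$. A subset of a topological space is comeager if it contains a dense $G_\delta$ subset. *)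

(* Defs.v *)
From HB Require Import structures.
From mathcomp Require Import all_boot all_order all_algebra.
From mathcomp Require Import all_classical all_reals topology ereal.
Set Implicit Arguments. Unset Strict Implicit. Unset Printing Implicit Defensive.
Import Order.TTheory GRing.Theory Num.Theory.
Local Open Scope classical_set_scope.
Local Open Scope ring_scope.

Section Defs.
Variables (R : realType) (X : topologicalType).

Definition is_metric (d : X -> X -> R) : Prop :=
  (forall x y, 0 <= d x y) /\
  (forall x y, d x y = 0 <-> x = y) /\
  (forall x y, d x y = d y x) /\
  (forall x y z, d x z <= d x y + d y z).

Definition dball (d : X -> X -> R) (x : X) (r : R) : set X :=
  [set y | d x y < r].

Definition generates_topology (d : X -> X -> R) : Prop :=
  forall A : set X,
    open A <-> (forall x, A x -> exists2 r : R, 0 < r & dball d x r `<=` A).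

Definition Met : set (X -> X -> R) :=
  [set d | is_metric d /\ generates_topology d].

Definition metrizable : Prop := exists d, Met d.

Definition strongly_zero_dim : Prop :=
  forall A B : set X, closed A -> closed B -> A `&` B = set0 ->
    exists V : set X, [/\ open V, closed V, A `<=` V & V `&` B = set0].

Definition sigma_compact : Prop :=
  exists K : nat -> set X, (forall n, compact (K n)) /\
    \bigcup_n K n = [set: X].

Definition supD (d e : X -> X -> R) : \bar R :=
  ereal_sup [set (`|d p.1 p.2 - e p.1 p.2|)%:E | p in [set: X * X]].

Definition Dball (d : X -> X -> R) (r : R) : set (X -> X -> R) :=
  [set e | Met e /\ (supD d e < r%:E)%E].

Definition Met_open (U : set (X -> X -> R)) : Prop :=
  U `<=` Met /\ forall d, U d -> exists2 r : R, 0 < r & Dball d r `<=` U.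

Definition Met_dense (G : set (X -> X -> R)) : Prop :=
  G `<=` Met /\ forall U, Met_open U -> U !=set0 -> U `&` G !=set0.

Definition Met_Gdelta (G : set (X -> X -> R)) : Prop :=
  exists U : nat -> set (X -> X -> R), (forall n, Met_open (U n)) /\
    G = \bigcap_n U n.

Definition Met_comeager (S : set (X -> X -> R)) : Prop :=
  exists G, [/\ Met_Gdelta G, Met_dense G & G `<=` S].

Definition rigid (d : X -> X -> R) : Prop :=
  forall f : X -> X, bijective f -> (forall x y, d (f x) (f y) = d x y) ->
    forall x, f x = x.

Definition RigidMet : set (X -> X -> R) := [set d | Met d /\ rigid d].

End Defs.

Arguments metrizable : clear implicits.
Arguments strongly_zero_dim : clear implicits.
Arguments sigma_compact : clear implicits.
Arguments RigidMet : clear implicits.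
Arguments Met : clear implicits.

(* Main.v *)
(** A metric is strongly rigid when [d x y] determines the unordered pair
    [{x, y}] as soon as [x <> y]; with at least three points this forces
    rigidity. On a sigma-compact space strong rigidity is a countable
    intersection of conditions over compact sets of quadruples, each of them
    open.
    For density, round [d] up to a multiple of [eps] after replacing each point
    by a locally constant approximation (rounding up preserves the triangle
    inequality), and add a metric [h < eps] whose value is the expansion, in a
    rapidly decreasing mixed radix, of digits coding the unordered pairs of
    cylinders containing [x] and [y] with respect to a countable clopen base.
    The sum determines [h], and [h] determines the pair. *)
Require Import Defs.
From HB Require Import structures.
From mathcomp Require Import all_boot all_order all_algebra.
From mathcomp Require Import zify ring lra.
From mathcomp Require Import all_classical all_reals topology ereal normedtype.
Set Implicit Arguments. Unset Strict Implicit. Unset Printing Implicit Defensive.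
Import Order.TTheory GRing.Theory Num.Theory numFieldNormedType.Exports.
Local Open Scope classical_set_scope.
Local Open Scope ring_scope.

(** * Metrics generating the topology *)

Section MetricFacts.
Variables (R : realType) (X : topologicalType) (d : X -> X -> R).
Hypothesis dM : Met R X d.

Lemma met_ge0 x y : 0 <= d x y. Proof. by case: dM => -[]. Qed.

Lemma met_eq0 x y : d x y = 0 <-> x = y. Proof. by case: dM => -[_ []]. Qed.

Lemma met_refl x : d x x = 0. Proof. exact/met_eq0. Qed.

Lemma met_gt0 x y : x <> y -> 0 < d x y.
Proof.
by move=> xy; rewrite lt_neqAle met_ge0 andbT; apply/eqP => /esym/met_eq0.
Qed.

Lemma met_sym x y : d x y = d y x. Proof. by case: dM => -[_ [_ []]]. Qed.

Lemma met_triangle y x z : d x z <= d x y + d y z.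
Proof. by case: dM => -[_ [_ []]]. Qed.

Lemma open_dball x r : open (dball d x r).
Proof.
case: dM => _ gd; apply/gd => y; rewrite /dball /= => xy.
exists (r - d x y); first by rewrite subr_gt0.
by move=> z; rewrite /dball /= => yz; have := met_triangle y x z; lra.
Qed.

Lemma nbhs_dball x r : 0 < r -> nbhs x (dball d x r).
Proof.
by move=> r0; apply: open_nbhs_nbhs; split; [exact: open_dball|rewrite /dball /= met_refl].
Qed.

Lemma met_closed1 (x : X) : closed [set x].
Proof.
rewrite -[X in closed X]setCK; apply: open_closedC.
case: dM => _ gd; apply/gd => y /= yx; exists (d y x); first exact: met_gt0.
by move=> z; rewrite /dball /= => yz zx; move: yz; rewrite zx ltxx.
Qed.

Lemma met_continuous (T : topologicalType) (f g : T -> X) :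
  continuous f -> continuous g -> continuous (fun t => d (f t) (g t)).
Proof.
move=> cf cg t; apply/cvgrPdist_lt => e e0.
have e20 : 0 < e / 2 by lra.
have Hf := cf t _ (nbhs_dball (f t) e20).
have Hg := cg t _ (nbhs_dball (g t) e20).
move: Hf Hg; rewrite !nbhs_simpl /dball /= => Hf Hg.
near=> s.
have H1 : d (f t) (f s) < e / 2 by near: s.
have H2 : d (g t) (g s) < e / 2 by near: s.
rewrite ltr_norml.
have := met_triangle (f s) (f t) (g t).
have := met_triangle (g s) (f s) (g t).
have := met_triangle (f t) (f s) (g s).
have := met_triangle (g t) (f t) (g s).
rewrite (met_sym (f s) (f t)) (met_sym (g s) (g t)) => *.
by apply/andP; split; lra.
Unshelve. all: by end_near. Qed.

End MetricFacts.

(** * A countable base of clopen sets *)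

Lemma compact_coverE (X : topologicalType) (x0 : X) : compact = @cover_compact X.
Proof.
pose T : ptopologicalType := HB.pack X (isPointed.Build X x0).
exact: (@compact_cover T).
Qed.

Definition clopen_base (X : topologicalType) (B : nat -> set X) : Prop :=
  (forall n, clopen (B n)) /\
  (forall (A : set X) x, open A -> A x -> exists2 n, B n x & B n `<=` A).

(** Strong zero-dimensionality puts a clopen set between [x] and its ball of radius 1/(k+1). For
    each [k], finitely many of these cover the compact set [K m]; collecting them over all [m] and
    [k] gives a countable base. *)
Lemma exists_clopen_base (R : realType) (X : topologicalType) (x0 : X) :
  metrizable R X -> strongly_zero_dim X -> sigma_compact X ->
  exists B : nat -> set X, clopen_base B.
Proof.
move=> [d dM] szd [K [Kc Kcov]].
have /choice[V HV] : forall kx : nat * X, exists V : set X,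
    [/\ open V, closed V, V kx.2 & V `<=` dball d kx.2 (kx.1.+1%:R)^-1].
  move=> [k x] /=.
  have [|||V [oV cV xV VA]] := szd [set x] (~` dball d x (k.+1%:R)^-1).
  - exact: met_closed1 dM x.
  - by apply: open_closedC; apply: open_dball.
  - apply/seteqP; split => // y /= [-> ]; apply.
    by rewrite /dball /= (met_refl dM).
  exists V; split => //; first exact: xV.
  move=> y Vy; apply: contrapT => yA.
  by have : set0 y by rewrite -VA.
have /choice[D HD] : forall mk : nat * nat, exists D : seq X,
    K mk.1 `<=` \bigcup_(x in [set` D]) V (mk.2, x).
  move=> [m k] /=.
  have := Kc m; rewrite (compact_coverE x0).
  move=> /(_ X setT (fun x => V (k, x)))[||D _ KD].
  - by move=> x _; have [] := HV (k, x).
  - by move=> x _; exists x => //; have [] := HV (k, x).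
  - by exists (finmap.enum_fset D).
(* The last index is a position in the finite cover; positions out of range, like numbers coding no
   triple below, give the empty set, which is clopen. *)
pose B' (p : nat * nat * nat) : set X :=
  nth set0 [seq V (p.1.2, x) | x <- D p.1] p.2.
have B'clopen p : clopen (B' p).
  rewrite /B'; case: (ltnP p.2 (size (D p.1))) => lp.
    by rewrite (nth_map x0) //; have [] := HV (p.1.2, nth x0 (D p.1) p.2).
  by rewrite nth_default ?size_map//; split; [exact: open0|exact: closed0].
exists (fun n => if unpickle n is Some p then B' p else set0); split.
  by move=> n; case: unpickle => [p|]; [exact: B'clopen | split; [exact: open0|exact: closed0]].
move=> A x oA Ax; have [_ gd] := dM.
have [r r0 rA] := (gd A).1 oA x Ax.
(* Half of [r], because the covering set lies in a ball around another point [y], and [x] and [z]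
   are compared through [y]. *)
have [k kr] : exists k : nat, (k.+1%:R)^-1 < r / 2.
  have [k hk] := ltr_add_invr (y := 0) (x := r / 2) ltac:(lra).
  by exists k; move: hk; rewrite add0r.
have [m _ Kmx] : (\bigcup_n K n) x by rewrite Kcov.
have [y /= yD Vyx] := HD (m, k) x Kmx.
exists (pickle (m, k, index y (D (m, k)))); rewrite pickleK /B' /=;
  rewrite (nth_map x0) ?index_mem// nth_index//.
have [_ _ _ Vk] := HV (k, y).
move=> z Vyz; apply: rA.
have := Vk _ Vyx; have := Vk _ Vyz; rewrite /dball /= => H1 H2.
have := lt_trans H1 kr; have := lt_trans H2 kr.
by have := met_triangle dM y x z; rewrite (met_sym dM x y); lra.
Qed.

(** * Mixed radix expansions *)

Section Expansion.
Variables (R : realType) (M : nat -> nat) (t0 : R).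
Hypotheses (M_gt0 : forall n, (0 < M n)%N) (t0_gt0 : 0 < t0).

(** [tail n] bounds the total contribution of the digits from index [n] on. Digit [n] has weight
    [2 * tail n.+1] and is at most [2 * M n], so it uses up to [4 * M n] of the [4 * M n + 1] parts,
    leaving one for the later digits. The factor 2 makes one unit of a digit outweigh everything
    after it. *)
Fixpoint tail (n : nat) : R :=
  if n is m.+1 then tail m / (4 * (M m)%:R + 1) else t0.

Definition psum (a : nat -> nat) (n : nat) : R :=
  \sum_(k < n) (a k)%:R * (2 * tail k.+1).

Definition expansion (a : nat -> nat) : R := sup (range (psum a)).

Lemma tailS n : tail n = (4 * (M n)%:R + 1) * tail n.+1.
Proof.
have M0 : 0 <= (M n)%:R :> R by rewrite ler0n.
by rewrite /=; field; lra.
Qed.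

Lemma tail_gt0 n : 0 < tail n.
Proof.
by elim: n => [|n IH] //=; apply: divr_gt0; rewrite ?ltr_wpDl ?mulr_ge0 ?ler0n.
Qed.

Lemma tail_small (r : R) : 0 < r -> exists n, tail n < r.
Proof.
(* A crude bound is enough: each step divides the tail by at least 5, while the factor [n.+1] at
   most doubles. *)
move=> r0; have le_t n : tail n * n.+1%:R <= t0.
  elim: n => [|n IH]; first by rewrite mulr1.
  apply: le_trans IH; rewrite (tailS n) -(natr1 n.+1) -(natr1 n).
  have M1 : 1 <= (M n)%:R :> R by rewrite ler1n.
  have n0 : 0 <= n%:R :> R by [].
  rewrite [leRHS]mulrAC [leRHS]mulrC ler_wpM2l ?(ltW (tail_gt0 _))//.
  by nra.
have [k hk] := ltr_add_invr (y := 0) (x := r / t0) ltac:(exact: divr_gt0).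
exists k; have := le_t k; rewrite -ler_pdivlMr ?ltr0n// => /le_lt_trans; apply.
by move: hk; rewrite add0r ltr_pdivlMr// mulrC.
Qed.

Lemma psumS a n : psum a n.+1 = psum a n + (a n)%:R * (2 * tail n.+1).
Proof. by rewrite /psum big_ord_recr. Qed.

Lemma psum_nondecreasing a m n : (m <= n)%N -> psum a m <= psum a n.
Proof.
move=> /subnK <-; elim: (n - m)%N => [|k IH] //; rewrite addSn psumS.
apply: (le_trans IH); rewrite lerDl mulr_ge0 ?ler0n//.
by have := tail_gt0 (k + m).+1; lra.
Qed.

Section Digits.
Variable a : nat -> nat.
Hypothesis a_le : forall k, (a k <= 2 * M k)%N.

(** The decrease of the tail at each step is at least the largest possible new term. The intervals
    from [psum a n] to [psum a n + tail n] are therefore nested, and they enclose the expansion. *)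
Lemma psum_tail_nonincreasing m n : (m <= n)%N ->
  psum a n + tail n <= psum a m + tail m.
Proof.
move=> /subnK <-; elim: (n - m)%N => [|k IH] //; rewrite addSn psumS.
apply: le_trans IH; rewrite (tailS (k + m)).
have : (a (k + m)%N)%:R <= 2 * (M (k + m)%N)%:R :> R by rewrite -natrM ler_nat.
by have := tail_gt0 (k + m).+1; nra.
Qed.

Lemma psum_le m n : psum a n <= psum a m + tail m.
Proof.
have [mn|/ltnW nm] := leqP m n.
  by have := psum_tail_nonincreasing mn; have := tail_gt0 n; lra.
by have := psum_nondecreasing a nm; have := tail_gt0 m; lra.
Qed.

Lemma expansion_ge n : psum a n <= expansion a.
Proof.
apply: ub_le_sup; last by exists n.
by exists (psum a 0 + tail 0) => _ [m _ <-]; exact: psum_le.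
Qed.

Lemma expansion_le n : expansion a <= psum a n + tail n.
Proof.
apply: ge_sup; first by exists (psum a 0), 0%N.
by move=> _ [m _ <-]; exact: psum_le.
Qed.

Lemma expansion_ge0 : 0 <= expansion a.
Proof. by have := expansion_ge 0; rewrite /psum big_ord0. Qed.

Lemma expansion_le_t0 : expansion a <= t0.
Proof. by have := expansion_le 0; rewrite /psum big_ord0 add0r. Qed.

Lemma expansion_lt_digit n : expansion a < tail n.+1 -> a n = 0%N.
Proof.
move=> h; apply/eqP; rewrite -leqn0 leqNgt; apply/negP => an.
have := expansion_ge n.+1; rewrite psumS.
have : 0 <= psum a n by have := psum_nondecreasing a (leq0n n); rewrite {1}/psum big_ord0.
have : 1 <= (a n)%:R :> R by rewrite ler1n.
by have := tail_gt0 n.+1; nra.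
Qed.

End Digits.

Lemma eq_psum a b n : (forall k, (k < n)%N -> a k = b k) -> psum a n = psum b n.
Proof. by move=> ab; apply: eq_bigr => k _; rewrite ab. Qed.

(** At the first difference [b] gains at least [2 * tail n.+1], whereas the later digits of [a]
    recover at most [tail n.+1]. *)
Lemma expansion_lt a b n :
  (forall k, a k <= 2 * M k)%N -> (forall k, b k <= 2 * M k)%N ->
  (forall k, (k < n)%N -> a k = b k) -> (a n < b n)%N ->
  expansion a < expansion b.
Proof.
move=> aM bM ab lab; have := expansion_le aM n.+1; have := expansion_ge bM n.+1.
rewrite !psumS (eq_psum ab).
have : (a n)%:R + 1 <= (b n)%:R :> R by rewrite natr1 ler_nat.
by have := tail_gt0 n.+1; nra.
Qed.

Lemma expansion_inj a b :
  (forall k, a k <= 2 * M k)%N -> (forall k, b k <= 2 * M k)%N ->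
  expansion a = expansion b -> forall n, a n = b n.
Proof.
move=> aM bM eab n; elim/ltn_ind: n => n IH.
case: (ltngtP (a n) (b n)) => // lt.
  by have := expansion_lt aM bM IH lt; rewrite eab ltxx.
have IH' k : (k < n)%N -> b k = a k by move=> /IH.
by have := expansion_lt bM aM IH' lt; rewrite eab ltxx.
Qed.

Lemma expansion_triangle a b c :
  (forall k, b k <= 2 * M k)%N -> (forall k, c k <= 2 * M k)%N ->
  (forall k, a k <= b k + c k)%N -> expansion a <= expansion b + expansion c.
Proof.
move=> bM cM abc; apply: ge_sup; first by exists (psum a 0), 0%N.
move=> _ [n _ <-]; apply: (@le_trans _ _ (psum b n + psum c n)); last first.
  by apply: lerD; exact: expansion_ge.
rewrite /psum -big_split /=; apply: ler_sum => k _.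
rewrite -mulrDl -natrD ler_wpM2r ?ler_nat//.
by have := tail_gt0 k.+1 => /=; lra.
Qed.

Lemma eq_expansion a b : a =1 b -> expansion a = expansion b.
Proof. by move=> ab; congr expansion; exact: funext. Qed.

End Expansion.

(** * Cylinders of a clopen base and codes of pairs *)

Section Words.
Variables (X : topologicalType) (B : nat -> set X).
Hypothesis hB : clopen_base B.

(** The binary number whose bits record membership in [B 0], ..., [B n.-1]; it names the cylinder of
    level [n] that contains [x]. *)
Fixpoint word (n : nat) (x : X) : nat :=
  if n is m.+1 then (word m x).*2 + `[< B m x >] else 0.

Lemma word_lt n x : (word n x < 2 ^ n)%N.
Proof. by elim: n => //= n; rewrite expnS; case: asboolP => _ /=; lia. Qed.

Lemma wordS n x y : word n.+1 x = word n.+1 y <->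
  word n x = word n y /\ `[< B n x >] = `[< B n y >].
Proof.
split=> [|[/= -> ->]] //=.
by case: asboolP => _; case: asboolP => _ /=; lia.
Qed.

Lemma word_le m n x y : (m <= n)%N -> word n x = word n y -> word m x = word m y.
Proof.
by move=> /subnK <-; elim: (n - m)%N => // k IH; rewrite addSn => /wordS[/IH].
Qed.

Lemma word_base n x y : word n.+1 x = word n.+1 y -> B n x -> B n y.
Proof. by move=> /wordS[_ e] /asboolP; rewrite e => /asboolP. Qed.

Lemma nbhs_word n x : nbhs x [set y | word n y = word n x].
Proof.
elim: n => [|n IH]; first exact: nearW.
have [oB cB] := hB.1 n.
have : nbhs x [set y | `[< B n y >] = `[< B n x >]].
  have [Bx|nBx] := asboolP (B n x).
    by apply: filterS (open_nbhs_nbhs (conj oB Bx)) => y /= /asboolP.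
  apply: filterS (open_nbhs_nbhs (conj (closed_openC cB) nBx)) => y /=.
  by move=> nBy; apply/asboolPn.
by apply: filterS2 IH => y /= H1 H2; rewrite H1 H2.
Qed.

Lemma word_inj x y : closed [set y] -> (forall n, word n x = word n y) -> x = y.
Proof.
move=> cy xy; apply: contrapT => nxy.
have [n Bx By] := hB.2 _ x (closed_openC cy) nxy.
exact: (By _ (word_base (xy n.+1) Bx)) erefl.
Qed.

(* The digit codes the unordered pair of words; shifting the nonzero codes by
   4^n puts them in the range [4^n, 2 * 4^n], where the triangle inequality is
   automatic. *)
Definition digit (x y : X) (n : nat) : nat :=
  if word n x == word n y then 0%N
  else (4 ^ n + (maxn (word n x) (word n y)) ^ 2 + minn (word n x) (word n y))%N.

Lemma digit_le x y n : (digit x y n <= 2 * 4 ^ n)%N.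
Proof.
rewrite /digit; case: eqP => // ne.
(* With [N = 2 ^ n] both words are at most [N - 1], so the square plus the minimum is at most
   [(N - 1) * N], below [4 ^ n]. *)
have := word_lt n x; have := word_lt n y.
have -> : (4 ^ n = 2 ^ n * 2 ^ n)%N by rewrite -expnMn.
move: (2 ^ n)%N (word n x) (word n y) ne => N a b; nia.
Qed.

Lemma digit_sym x y n : digit x y n = digit y x n.
Proof. by rewrite /digit eq_sym maxnC minnC. Qed.

Lemma digit_eq0 x y n : digit x y n = 0%N <-> word n x = word n y.
Proof.
rewrite /digit; case: eqP => // ne; split=> // /eqP.
by rewrite -addnA addn_eq0 expn_eq0.
Qed.

Lemma digit_triangle y x z n : (digit x z n <= digit x y n + digit y z n)%N.
Proof.
have [/digit_eq0 e|xy] := eqVneq (digit x y n) 0%N.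
  by rewrite /digit e leq_addl.
have [/digit_eq0 e|yz] := eqVneq (digit y z n) 0%N.
  by rewrite /digit e leq_addr.
apply: (leq_trans (digit_le _ _ _)); rewrite mul2n -addnn.
by apply: leq_add; [move: xy|move: yz]; rewrite /digit; case: ifP => //; lia.
Qed.

Lemma digit_inj x y u v n : word n x <> word n y ->
  digit x y n = digit u v n ->
  (word n x = word n u /\ word n y = word n v) \/
  (word n x = word n v /\ word n y = word n u).
Proof.
rewrite /digit; case: eqP => // _ ne; case: eqP => [_ /eqP|_].
  by rewrite -addnA addn_eq0 expn_eq0.
rewrite -!addnA => /addnI.
move: (word n x) (word n y) (word n u) (word n v) ne => a b c e ne h.
(* As the minimum is at most the maximum [m], the code lies between [m ^ 2] and [(m + 1) ^ 2], the
   latter excluded, and so determines [m]. *)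
have eqm : maxn a b = maxn c e.
  have : (minn a b <= maxn a b)%N by lia.
  have : (minn c e <= maxn c e)%N by lia.
  by move: (maxn a b) (minn a b) (maxn c e) (minn c e) h => m k m' k'; nia.
by move: h; rewrite eqm => /addnI; lia.
Qed.

End Words.


(** * Strong rigidity implies rigidity *)

Definition strongly_rigid (R : realType) (X : Type) (d : X -> X -> R) : Prop :=
  forall x y u v, x <> y -> d x y = d u v -> (x = u /\ y = v) \/ (x = v /\ y = u).

(** If an isometry [f] moves [x], then for every other [y] the pairs {x, y} and {f x, f y} coincide,
    which forces [y = f x]. So [x] and [f x] would be the only points. *)
Lemma strongly_rigid_rigid (R : realType) (X : topologicalType) (d : X -> X -> R) :
  (exists x y z : X, [/\ x <> y, y <> z & x <> z]) -> strongly_rigid d -> rigid d.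
Proof.
move=> [a [b [c [ab bc ac]]]] sr f _ fd x; apply: contrapT => fx.
have fxE y : x <> y -> f x = y.
  by move=> xy; have [[/esym]|[-> //]] := sr x y (f x) (f y) xy (esym (fd x y)).
have [xa|xa] := pselect (x = a).
  by apply: bc; apply: etrans (esym (fxE b _)) (fxE c _); rewrite xa.
have [xb|xb] := pselect (x = b).
  by apply: ac; apply: etrans (esym (fxE a _)) (fxE c _); rewrite // xb.
by apply: ab; apply: etrans (esym (fxE a _)) (fxE b _).
Qed.

Lemma continuous_fst_comp (T U V : topologicalType) (f : T -> U * V) :
  continuous f -> continuous (fun t => (f t).1).
Proof. by move=> cf t; exact: (cvg_comp _ _ (cf t) cvg_fst). Qed.

Lemma continuous_snd_comp (T U V : topologicalType) (f : T -> U * V) :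
  continuous f -> continuous (fun t => (f t).2).
Proof. by move=> cf t; exact: (cvg_comp _ _ (cf t) cvg_snd). Qed.

(** * Strongly rigid metrics form a G-delta set *)

Section Gdelta.
Variables (R : realType) (X : topologicalType).

Lemma supD_lt (d e : X -> X -> R) r x y :
  (supD d e < r%:E)%E -> `|d x y - e x y| < r.
Proof.
rewrite -lte_fin; apply: le_lt_trans; apply: ereal_sup_ubound.
by exists (x, y).
Qed.

(** The difference of the two distances is continuous, so its image of [L] is closed and avoids a
    ball of radius [r] around 0. Changing each distance by less than [r / 2] moves the difference by
    less than [r]. *)
Lemma Met_open_separating (L : set (X * X * X * X)) : compact L ->
  Met_open [set d | Met R X d /\
    forall p, L p -> d p.1.1.1 p.1.1.2 <> d p.1.2 p.2].
Proof.
move=> cL; split=> [d []//|d [dM dL]].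
pose g (p : X * X * X * X) := d p.1.1.1 p.1.1.2 - d p.1.2 p.2.
have cg : continuous g.
  move=> p; apply: continuousB; apply: (met_continuous dM).
  - by do 3 apply: continuous_fst_comp; move=> q; exact: cvg_id.
  - by apply: continuous_snd_comp; do 2 apply: continuous_fst_comp; move=> q; exact: cvg_id.
  - by apply: continuous_snd_comp; apply: continuous_fst_comp; move=> q; exact: cvg_id.
  - apply: continuous_snd_comp; move=> q; exact: cvg_id.
have cgL : closed (g @` L).
  apply: compact_closed; first exact: norm_hausdorff.
  by apply: continuous_compact => //; exact: continuous_subspaceT.
have : nbhs (0 : R) (~` (g @` L)).
  apply: open_nbhs_nbhs; split; first exact: closed_openC.
  by move=> [p Lp] /eqP; rewrite subr_eq0 => /eqP; exact: dL.
move=> /nbhs_ballP[r /= r0 rL]; exists (r / 2); first lra.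
move=> e [eM de]; split=> // p Lp ee.
apply: (rL (g p)); last by exists p.
rewrite /ball /= sub0r normrN /g.
have := supD_lt p.1.1.1 p.1.1.2 de; have := supD_lt p.1.2 p.2 de.
rewrite ee !ltr_norml => /andP[? ?] /andP[? ?]; apply/andP; split; lra.
Qed.

Lemma Met_Gdelta_countable (T : countType) (U : T -> set (X -> X -> R)) :
  inhabited T -> (forall i, Met_open (U i)) -> Met_Gdelta (\bigcap_i U i).
Proof.
(* Numbers coding no index repeat [U i0], which leaves the intersection unchanged. *)
move=> [i0] oU; exists (fun n => U (odflt i0 (unpickle n))); split => //.
apply/seteqP; split=> d dU => [n _|i _]; first exact: dU.
by have := dU (pickle i) I; rewrite pickleK.
Qed.

Lemma strongly_rigid_Gdelta : metrizable R X -> sigma_compact X ->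
  Met_Gdelta [set d | Met R X d /\ strongly_rigid d].
Proof.
move=> [d dM] [K [Kc Kcov]].
(* The fixed metric [d] makes the conditions quantitative: in [L i] the points [x], [y] are at least
   1/(n+1) apart, and so is the pair (x, y) from both orderings of [u], [v]. These closed conditions
   cut out compact sets, whose union over [i] consists of all quadruples that strong rigidity must
   separate. *)
pose L (i : nat * nat * nat * nat * nat) : set (X * X * X * X) :=
  (K i.1.1.1.1 `*` K i.1.1.1.2 `*` K i.1.1.2 `*` K i.1.2) `&`
  [set p | (i.2.+1%:R)^-1 <= d p.1.1.1 p.1.1.2] `&`
  [set p | (i.2.+1%:R)^-1 <= d p.1.1.1 p.1.2 + d p.1.1.2 p.2] `&`
  [set p | (i.2.+1%:R)^-1 <= d p.1.1.1 p.2 + d p.1.1.2 p.1.2].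
have c111 : continuous (fun p : X * X * X * X => p.1.1.1).
  by do 3 apply: continuous_fst_comp; move=> q; exact: cvg_id.
have c112 : continuous (fun p : X * X * X * X => p.1.1.2).
  by apply: continuous_snd_comp; do 2 apply: continuous_fst_comp; move=> q; exact: cvg_id.
have c12 : continuous (fun p : X * X * X * X => p.1.2).
  by apply: continuous_snd_comp; apply: continuous_fst_comp; move=> q; exact: cvg_id.
have c2 : continuous (fun p : X * X * X * X => p.2).
  by apply: continuous_snd_comp; move=> q; exact: cvg_id.
have cge (f : X * X * X * X -> R) (r : R) :
    continuous f -> closed [set p | r <= f p].
  move=> cf; apply: (@preimage_closed _ _ f [set x | r <= x]).
    by move=> x _; exact: cf.
  exact: closed_ge.
have cL i : compact (L i).
  do 3 (apply: compact_closedI; last first; first (apply: cge => p;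
     try apply: continuousD; exact: (met_continuous dM))).
  by do 3 (apply: compact_setX => //).
suff -> : [set d | Met R X d /\ strongly_rigid d] =
    \bigcap_i [set e | Met R X e /\
      forall p, L i p -> e p.1.1.1 p.1.1.2 <> e p.1.2 p.2].
  apply: Met_Gdelta_countable; first exact: (inhabits (0, 0, 0, 0, 0)%N).
  by move=> i; exact: Met_open_separating.
apply/seteqP; split=> e /= => [[eM er] i _|eL].
  split=> // p [[[_ /= xy] /= xuyv] /= xvyu] pe.
  have i0 : 0 < (i.2.+1%:R)^-1 :> R by rewrite invr_gt0 ltr0n.
  have nxy : p.1.1.1 <> p.1.1.2.
    by move=> E; move: xy; rewrite E (met_refl dM) leNgt i0.
  case: (er _ _ _ _ nxy pe) => -[E1 E2].
    by move: xuyv; rewrite E1 E2 !(met_refl dM) addr0 leNgt i0.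
  by move: xvyu; rewrite E1 E2 !(met_refl dM) addr0 leNgt i0.
split; first by have [] := eL (0, 0, 0, 0, 0)%N I.
move=> x y u v xy exy; apply: contrapT => nuv.
pose m := Num.min (d x y) (Num.min (d x u + d y v) (d x v + d y u)).
have sum_gt0 a b a' b' : ~ (a = a' /\ b = b') -> 0 < d a a' + d b b'.
  move=> ne; have := met_ge0 dM a a'; have := met_ge0 dM b b' => h1 h2.
  rewrite lt_neqAle addr_ge0// andbT eq_sym paddr_eq0//.
  by apply/negP => /andP[/eqP/(met_eq0 dM) E1 /eqP/(met_eq0 dM) E2]; exact: ne.
have m0 : 0 < m.
  rewrite !lt_min (met_gt0 dM xy) !sum_gt0// => E; apply: nuv; [by right|by left].
have [n hn] := ltr_add_invr m0; rewrite add0r in hn.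
have inK z : exists i, K i z.
  have [i _ Kz] : (\bigcup_n K n) z by rewrite Kcov.
  by exists i.
have [i Ki] := inK x; have [j Kj] := inK y.
have [k Kk] := inK u; have [l Kl] := inK v.
move: hn; rewrite !lt_min => /and3P[/ltW h1 /ltW h2 /ltW h3].
by have [_ /(_ (x, y, u, v))] := eL (i, j, k, l, n) I; apply.
Qed.

End Gdelta.

(** * Locally constant approximation of points *)

Lemma locally_constant_approximation (R : realType) (X : topologicalType)
    (x0 : X) (B : nat -> set X) (d : X -> X -> R) (eps : R) :
  clopen_base B -> Met R X d -> 0 < eps ->
  exists p : X -> X, (forall x, d x (p x) < eps) /\
    forall x, nbhs x [set y | p y = p x].
Proof.
move=> hB dM eps0.
pose small n := forall y z, B n y -> B n z -> d y z < eps.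
have ex x : exists n, `[< B n x /\ small n >].
  have xb : dball d x (eps / 2) x by rewrite /dball /= (met_refl dM); lra.
  have [n Bx nb] := hB.2 _ _ (open_dball dM x _) xb.
  exists n; apply/asboolP; split=> // y z /nb + /nb; rewrite /dball /=.
  by have := met_triangle dM x y z; rewrite (met_sym dM y x); lra.
(* The first small base set containing [x]; its chosen point will be [p x]. Since [idx x] depends
   only on membership of [x] in the base sets up to that index, it is constant on the cylinder of
   level [(idx x).+1]. *)
pose idx x := ex_minn (ex x).
have idxP x : B (idx x) x /\ small (idx x).
  by rewrite /idx; case: ex_minnP => n /asboolP.
exists (fun x => xget x0 (B (idx x))); split=> x.
  have [Bx sx] := idxP x; apply: sx => //.
  by apply: (@xgetPex _ x0 (B (idx x))); exists x.
apply: filterS (nbhs_word hB (idx x).+1 x) => y /= xy.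
suff -> : idx y = idx x by [].
have Bxy j : (j <= idx x)%N -> B j x <-> B j y.
  move=> jx; have E := word_le (jx : (j < (idx x).+1)%N) xy.
  by split; apply: word_base.
apply/eqP; rewrite eqn_leq; apply/andP; split.
  rewrite {1}/idx; case: ex_minnP => n _; apply; apply/asboolP.
  by have [Bx sx] := idxP x; split=> //; apply/Bxy.
rewrite leqNgt; apply/negP => lt; have [By sy] := idxP y.
move: (lt); rewrite ltnNge => /negP; apply.
rewrite {1}/idx; case: ex_minnP => n _; apply; apply/asboolP; split=> //.
by apply/Bxy => //; exact: ltnW.
Qed.


(** * The rounded and coded perturbation of a metric *)

Section Perturbation.
Variables (R : realType) (X : topologicalType) (B : nat -> set X).
Variables (d : X -> X -> R) (p : X -> X) (eps : R).
Hypotheses (hB : clopen_base B) (dM : Met R X d) (eps_gt0 : 0 < eps).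
Hypotheses (dp : forall x, d x (p x) < eps).
Hypotheses (p_lc : forall x, nbhs x [set y | p y = p x]).

(** [M] matches the bound on the digits; [t0] is half of [eps] so that the coding metric stays
    strictly below [eps]. *)
Let M n := (4 ^ n)%N.
Let t0 : R := eps / 2.

Let M_gt0 n : (0 < M n)%N. Proof. by rewrite expn_gt0. Qed.
Let t0_gt0 : 0 < t0. Proof. exact: divr_gt0. Qed.
Let digM x y k : (digit B x y k <= 2 * M k)%N. Proof. exact: digit_le. Qed.

Definition coding_metric (x y : X) : R := expansion M t0 (digit B x y).

Definition rounded_metric (x y : X) : int := Num.ceil (d (p x) (p y) / eps).

Definition perturbed_metric (x y : X) : R :=
  eps * (rounded_metric x y)%:~R + coding_metric x y.

Let h := coding_metric.
Let c := rounded_metric.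
Let e := perturbed_metric.

Lemma coding_metric_ge0 x y : 0 <= h x y.
Proof. exact: expansion_ge0 (digM x y). Qed.

Lemma coding_metric_lt x y : h x y < eps.
Proof.
apply: le_lt_trans (expansion_le_t0 t0_gt0 (digM x y)) _.
by rewrite /t0 ltr_pdivrMr// ltr_pMr// ltr1n.
Qed.

(** Equal words of length [n] make the first [n] digits vanish. With the converse estimate below,
    small balls of [h] and cylinders refine each other. *)
Lemma coding_metric_near n x y : word B n y = word B n x -> h x y <= tail M t0 n.
Proof.
move=> yx; apply: le_trans (expansion_le t0_gt0 (digM x y) n) _.
rewrite (@eq_psum _ _ _ _ (fun=> 0%N)); last first.
  move=> k kn; apply/digit_eq0; exact: (word_le (ltnW kn) (esym yx)).
by rewrite /psum big1 ?add0r// => k _; rewrite mul0r.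
Qed.

Lemma coding_metric_lt_tail n x y : h x y < tail M t0 n.+1 -> word B n x = word B n y.
Proof. by move=> hn; apply/digit_eq0; exact: (expansion_lt_digit t0_gt0 (digM x y) hn). Qed.

Lemma coding_metric_refl x : h x x = 0.
Proof.
apply/eqP; rewrite eq_le coding_metric_ge0 andbT leNgt; apply/negP => h0.
have [n] := tail_small M_gt0 t0_gt0 h0.
by rewrite ltNge coding_metric_near.
Qed.

(** Equal values have equal digits, so at each level the unordered pairs of cylinders agree, though
    the matching might vary with the level. Points separated at one level stay separated later; if
    both matchings failed, a single high level would refute both. *)
Lemma coding_metric_inj x y u v : x <> y -> h x y = h u v ->
  (x = u /\ y = v) \/ (x = v /\ y = u).
Proof.
move=> xy /(expansion_inj t0_gt0 (digM x y) (digM u v)) dig.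
have sep a b : a <> b -> exists n, word B n a <> word B n b.
  move=> ab; apply: contrapT => /forallNP nab; apply: ab.
  apply: (word_inj hB) => [|n]; [exact: met_closed1 dM _|exact: contrapT (nab n)].
have mono m n a b : (m <= n)%N -> word B m a <> word B m b -> word B n a <> word B n b.
  by move=> mn ne E; apply: ne; exact: word_le mn E.
have [n0 N0] := sep x y xy.
have sep2 a b a' b' : ~ (a = a' /\ b = b') -> exists n, forall m, (n <= m)%N ->
    ~ (word B m a = word B m a' /\ word B m b = word B m b').
  move=> /not_andP[/sep|/sep] [n ne]; exists n => m nm [E1 E2].
    exact: mono nm ne E1.
  exact: mono nm ne E2.
apply: contrapT => /not_orP[/sep2[n1 N1] /sep2[n2 N2]].
pose n := maxn n0 (maxn n1 n2).
have l0 : (n0 <= n)%N by rewrite leq_maxl.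
have l1 : (n1 <= n)%N by rewrite leq_max (leq_maxl n1) orbT.
have l2 : (n2 <= n)%N by rewrite leq_max (leq_maxr n1) orbT.
by case: (digit_inj (mono _ _ _ _ l0 N0) (dig n)); [exact: N1|exact: N2].
Qed.

Lemma coding_metric_sym x y : h x y = h y x.
Proof. by apply: eq_expansion => n; exact: digit_sym. Qed.

Lemma coding_metric_triangle x y z : h x z <= h x y + h y z.
Proof.
by apply: (expansion_triangle t0_gt0 (digM x y) (digM y z)) => n; exact: digit_triangle.
Qed.

Lemma rounded_metric_ge0 x y : 0 <= c x y.
Proof.
rewrite ceil_ge0; apply: lt_le_trans (_ : 0 <= _); first lra.
by rewrite divr_ge0 ?(met_ge0 dM)// ltW.
Qed.

Lemma rounded_metric_triangle x y z : c x z <= c x y + c y z.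
Proof.
rewrite ceil_le_int intrD.
apply: le_trans (lerD (ceil_ge _) (ceil_ge _)).
rewrite -mulrDl ler_pM2r ?invr_gt0//; exact: met_triangle.
Qed.

Lemma rounded_metric_near x y : p x = p y -> c x y = 0.
Proof. by move=> pp; rewrite /c /rounded_metric pp (met_refl dM) mul0r ceil0. Qed.

Lemma coding_le_perturbed x y : h x y <= e x y.
Proof. by rewrite lerDr mulr_ge0 ?(ltW eps_gt0)// ler0z rounded_metric_ge0. Qed.

Lemma perturbed_metric_Met : Met R X e.
Proof.
have e_ge0 x y : 0 <= e x y := le_trans (coding_metric_ge0 x y) (coding_le_perturbed x y).
split; first split; first exact: e_ge0.
- split; last split.
  + move=> x y; split=> [exy|<-]; last first.
      by rewrite /e /perturbed_metric -/c -/h rounded_metric_near// coding_metric_refl mulr0 addr0.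
    apply: (word_inj hB) => [|n]; first exact: met_closed1 dM _.
    apply: coding_metric_lt_tail.
    apply: le_lt_trans (tail_gt0 _ t0_gt0 _).
    by rewrite -exy; exact: coding_le_perturbed.
  + move=> x y; rewrite /e /perturbed_metric -/c -/h coding_metric_sym.
    by rewrite /c /rounded_metric (met_sym dM).
  + move=> x y z; rewrite /e /perturbed_metric -/c -/h.
    rewrite addrACA -mulrDr lerD ?coding_metric_triangle// ler_wpM2l ?(ltW eps_gt0)//.
    by rewrite -intrD ler_int rounded_metric_triangle.
move=> A; split=> [oA x Ax|eA].
  have [n Bx BA] := hB.2 A x oA Ax.
  (* A value below [tail n.+2] gives equal words of length [n.+1], the first length that decides
     membership in [B n]. *)
  exists (tail M t0 n.+2); first exact: tail_gt0.
  move=> y exy; apply: BA; apply: word_base Bx; apply: coding_metric_lt_tail.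
  exact: le_lt_trans (coding_le_perturbed x y) exy.
rewrite openE => x Ax; have [r r0 rA] := eA x Ax.
have [n nr] := tail_small M_gt0 t0_gt0 r0.
(* Where [p] is constant the rounded part vanishes, so near [x] the perturbed metric is the coding
   metric. *)
apply: filterS2 (p_lc x) (nbhs_word hB n x) => y /= pxy wxy; apply: rA.
rewrite /dball /= /e /perturbed_metric -/c -/h rounded_metric_near// mulr0 add0r.
exact: le_lt_trans (coding_metric_near wxy) nr.
Qed.

(* Integer and fractional parts of [e / eps] are the rounded and the coding
   metric, so [e] determines the latter. *)
Lemma perturbed_metric_strongly_rigid : strongly_rigid e.
Proof.
move=> x y u v xy; rewrite /e /perturbed_metric -/c -/h => exy.
suff cE : c x y = c u v.
  by apply: coding_metric_inj => //; move: exy; rewrite cE => /addrI.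
have lt_c a b a' b' : eps * (c a b)%:~R + h a b = eps * (c a' b')%:~R + h a' b' ->
    c a b <= c a' b'.
  move=> E; rewrite -ltzD1 -(ltr_int R) intrD -(ltr_pM2l eps_gt0).
  have := coding_metric_ge0 a b; have := coding_metric_lt a' b'.
  by rewrite mulrDr mulr1; lra.
by apply/eqP; rewrite eq_le !lt_c.
Qed.

(** Moving both points by [p] costs at most [2 * eps]; rounding up and adding [h] cost at most [eps]
    each. *)
Lemma perturbed_metric_close x y : `|d x y - e x y| <= 4 * eps.
Proof.
have := ceil_ge (d (p x) (p y) / eps).
have := ceilB1_lt (d (p x) (p y) / eps).
rewrite -/(rounded_metric x y) -/(c x y) intrB ler_pdivrMr// ltr_pdivlMr//.
have := coding_metric_ge0 x y; have := coding_metric_lt x y.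
have := dp x; have := dp y.
have := met_triangle dM (p x) x y; have := met_triangle dM (p y) (p x) y.
have := met_triangle dM x (p x) (p y); have := met_triangle dM y x (p y).
rewrite (met_sym dM (p x) x) (met_sym dM (p y) y) /e /perturbed_metric -/c -/h.
by rewrite ler_norml => *; apply/andP; split; lra.
Qed.

End Perturbation.

(** * Density and comeagerness *)

Lemma strongly_rigid_dense (R : realType) (X : topologicalType) (x0 : X) :
  metrizable R X -> strongly_zero_dim X -> sigma_compact X ->
  Met_dense [set d : X -> X -> R | Met R X d /\ strongly_rigid d].
Proof.
move=> mX zX sX; split=> [d []//|U [UM oU] [d Ud]].
have [r r0 rU] := oU d Ud; have dM := UM d Ud.
have [B hB] := exists_clopen_base x0 mX zX sX.
(* With [eps = r / 8] all distances change by at most [r / 2], so the supremum stays strictly below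
   [r]. *)
have eps0 : 0 < r / 8 by lra.
have [p [dp p_lc]] := locally_constant_approximation x0 hB dM eps0.
have eM := perturbed_metric_Met hB dM eps0 p_lc.
exists (perturbed_metric B d p (r / 8)); split; last first.
  by split=> //; exact: perturbed_metric_strongly_rigid.
apply: rU; split=> //; apply: (@le_lt_trans _ _ (r / 2)%:E); last by rewrite lte_fin; lra.
apply: ge_ereal_sup => _ [[x y] _ <-]; rewrite lee_fin.
have := perturbed_metric_close B dM eps0 dp x y; lra.
Qed.

Theorem theorem1p3 (R : realType) (X : topologicalType) :
  metrizable R X ->
  strongly_zero_dim X ->
  sigma_compact X ->
  (exists x y z : X, [/\ x <> y, y <> z & x <> z]) ->
  (exists f : X -> R, injective f) ->
  Met_comeager (RigidMet R X).
Proof.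
move=> mX zX sX X3 _; have [x0 _] := X3.
exists [set d | Met R X d /\ strongly_rigid d]; split.
- exact: strongly_rigid_Gdelta.
- exact: strongly_rigid_dense x0 mX zX sX.
- by move=> d [dM dsr]; split=> //; exact: strongly_rigid_rigid.
Qed.
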